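(* Let $\mathbb{S}^1$ be the unit circle in $\mathbb{R}^2$ equipped with the arc length (geodesic) distance $d$, and let $P_X$ be the uniform distribution on $\mathbb{S}^1$. Then for every $x \in \mathbb{S}^1$, $D(x ; P_X) = \pi^2/6 - 1$.
   Context: Define $h: \mathcal{X}^3 \to \mathbb{R}$ by $h(x_1, x_2, x_3) := \mathbb{I}( x_3 \notin \{x_1, x_2\} ) \dfrac{ d^2(x_1, x_3) + d^2(x_2, x_3) - d^2(x_1, x_2) }{d(x_1, x_3)\, d(x_2, x_3) }$, where $h := 0$ when $x_3 \in \{x_1,x_2\}$. The metric spatial depth of $\mu \in \mathcal{X}$ with respect to a probability distribution $P_X$ on $\mathcal{X}$ is $D(\mu; P_X) := 1 - \frac{1}{2} \mathrm{E} \{ h(X_1, X_2, \mu) \}$, where $X_1, X_2 \sim P_X$ are independent. *)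

(* Defs.v *)
From HB Require Import structures.
From mathcomp Require Import all_boot all_order all_algebra.
From mathcomp Require Import all_classical all_reals all_analysis.
From mathcomp Require Import uniform_distribution.
Set Implicit Arguments. Unset Strict Implicit. Unset Printing Implicit Defensive.
Import Order.TTheory GRing.Theory Num.Theory.
Local Open Scope ring_scope.

Section msd.
Context {R : realType}.

Definition msd_h {M : eqType} (d : M -> M -> R) (x1 x2 x3 : M) : R :=
  if (x3 == x1) || (x3 == x2) then 0
  else (d x1 x3 ^+ 2 + d x2 x3 ^+ 2 - d x1 x2 ^+ 2) / (d x1 x3 * d x2 x3).

(* Expectation E{h(X1,X2,mu)} where X1 = X w1, X2 = X w2 with (w1,w2) drawn
   from the product P \x P, i.e. X1, X2 are independent with law P_X = X_* P. *)
Definition msd_expect {dT} {T : measurableType dT} (P : {measure set T -> \bar R})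
  {M : eqType} (X : T -> M) (d : M -> M -> R) (mu : M) : \bar R :=
  (\int[P \x P]_z (msd_h d (X z.1) (X z.2) mu)%:E)%E.

Definition msd_depth {dT} {T : measurableType dT} (P : {measure set T -> \bar R})
  {M : eqType} (X : T -> M) (d : M -> M -> R) (mu : M) : R :=
  1 - 2^-1 * fine (msd_expect P X d mu).

Definition S1 : set (R * R) := [set p | p.1 ^+ 2 + p.2 ^+ 2 = 1].
Definition circle_pt (t : R) : R * R := (cos t, sin t).

(* geodesic (arc-length) distance on S^1: the angle between unit vectors *)
Definition geodist (p q : R * R) : R := acos (p.1 * q.1 + p.2 * q.2).

Lemma twopi_gt0 : (0 : R) < 2 * pi.
Proof. by rewrite mulr_gt0 // pi_gt0. Qed.

(* uniform distribution of the angle on [0, 2 pi]; its image under circle_pt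
   is the uniform distribution on S^1 *)
Definition unif_angle := uniform_prob twopi_gt0.

End msd.

(* Main.v *)
Require Import Defs.
From HB Require Import structures.
From mathcomp Require Import all_boot all_order all_algebra.
From mathcomp Require Import all_classical all_reals all_analysis.
From mathcomp Require Import uniform_distribution.
From mathcomp Require Import measurable_realfun ring lra zify.
Import Order.TTheory GRing.Theory Num.Theory numFieldNormedType.Exports.
Local Open Scope ring_scope.

(** Let [c] be the angle of [x]. Since [|h| <= 2], Tonelli applies to [h + 2].
    Measure the angle of the first point from the antipode of [x], as
    [c + pi +- s], and that of the second from [x], as [c +- b], with
    [0 < s, b < pi]. If the two signs differ, [h = 2]; if they agree, [h + 2]
    vanishes for [b <= s] and otherwise equals
      [4 pi (b - s) / ((pi - s) b) = \sum_n 4 (s / pi)^n (1 - s / b)].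
    Integrating the monomials term by term gives
      [E h = 2 \sum_n 1 / ((n + 1) (n + 2)^2) = 2 (2 - pi^2 / 6)],
    by telescoping and the value of [\sum_n 1 / n^2]. The latter comes from the
    exact value of [\sum_(k < 2^n) 1 / sin^2 ((2 k + 1) pi / 2^(n + 2))] and
    [x cos x <= sin x <= x]. *)

(** * The value of the sum of inverse squares *)

Lemma sin_le_id {R : realType} (x : R) : 0 <= x -> sin x <= x.
Proof.
move=> x0.
have [|c _] := @MVT_segment R sin cos 0 x x0.
  by apply: continuous_subspaceT => y; exact: continuous_sin.
rewrite sin0 !subr0 => ->.
by rewrite -[leRHS]mul1r ler_wpM2r// cos_le1.
Qed.

(** The function [sin y - y cos y] vanishes at 0 and has derivative [y sin y], which is nonnegative
    up to [pi]. *)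
Lemma xcos_le_sin {R : realType} (x : R) : 0 <= x <= pi -> x * cos x <= sin x.
Proof.
move=> /andP[x0 xpi].
pose f (y : R) := sin y - y * cos y.
have df (y : R) : is_derive y 1 f (y * sin y).
  rewrite (_ : y * sin y = cos y - (y * - sin y + cos y * 1)); last by ring.
  by apply: is_deriveB; apply: is_deriveM.
have [|c] := @MVT_segment R f (fun y => y * sin y) 0 x x0.

  apply: continuous_subspaceT => y.
  by apply: differentiable_continuous; apply/derivable1_diffP; case: (df y).
rewrite in_itv/= => /andP[c0 cx].
rewrite /f sin0 mul0r !subr0 => fx.
rewrite -subr_ge0 fx !mulr_ge0// sin_ge0_pi// c0/=.
exact: le_trans xpi.
Qed.

(** These are the squares of [cot x <= 1 / x <= 1 / sin x], because [cot^2 x = 1 / sin^2 x - 1]. *)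
Lemma inv_sqr_bounds {R : realType} (x : R) : 0 < x < pi / 2 ->
  (sin x ^+ 2)^-1 - 1 <= (x ^+ 2)^-1 <= (sin x ^+ 2)^-1.
Proof.
move=> /andP[x0 xpi].
have pi0 := @pi_gt0 R.
have s0 : 0 < sin x by apply: sin_gt0_pihalf; rewrite x0.
have c0 : 0 < cos x by apply: cos_gt0_pihalf; rewrite xpi andbT; lra.
apply/andP; split; last first.
  rewrite lef_pV2 ?posrE ?exprn_gt0//.
  by rewrite lerXn2r ?nnegrE ?sin_le_id ?(ltW s0) ?(ltW x0).
have -> : (sin x ^+ 2)^-1 - 1 = (cos x / sin x) ^+ 2.
  by rewrite expr_div_n cos2sin2 mulrBl divff ?expf_neq0 ?gt_eqF// mul1r.
have cs0 : 0 <= cos x / sin x by rewrite divr_ge0 ?ltW.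
rewrite -exprVn lerXn2r ?nnegrE ?invr_ge0 ?(ltW x0)//.
rewrite ler_pdivrMr// mulrC ler_pdivlMr// mulrC.
by apply: xcos_le_sin; lra.
Qed.

(* Pairing [x] with [pi / 2 - x] and using [1 / sin^2 x + 1 / cos^2 x =
   4 / sin^2 (2 x)] reduces [n.+1] to [n]. *)
Lemma sum_inv_sin2 {R : realType} (n : nat) :
  \sum_(k < 2 ^ n) (sin (k.*2.+1%:R * pi / (4 * 2 ^+ n) : R) ^+ 2)^-1 =
  2 * 4 ^+ n.
Proof.
elim: n => [|n IH].
  rewrite expn0 big_ord1 !expr0 !mulr1 mul1r.
  suff -> : sin (pi / 4 : R) ^+ 2 = 2^-1 by rewrite invrK.
  have := @cos_mulr2n R (pi / 4).
  have -> : pi / 4 *+ 2 = pi / 2 :> R by rewrite mulr2n; lra.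
  rewrite cos_pihalf cos2sin2 mulr2n; lra.
pose g (k : nat) := (sin (k.*2.+1%:R * pi / (4 * 2 ^+ n.+1) : R) ^+ 2)^-1.
rewrite expnS mul2n -addnn -(big_mkord xpredT g).
rewrite (@big_cat_nat _ _ _ (2 ^ n)) ?leq_addr//=.
(* The upper half of the sum is listed backwards, so that its [k]-th angle is [pi / 2] minus the
   [k]-th angle of the lower half. *)
rewrite [X in _ + X](_ : _ = \sum_(0 <= k < 2 ^ n) g ((2 ^ n + 2 ^ n).-1 - k)%N).
  rewrite -big_split/= exprS mulrCA -IH mulr_sumr big_mkord.
  apply: eq_bigr => k _.
  set N : R := 2 ^+ n.
  have N0 : 0 < N by rewrite exprn_gt0.
  have pi0 := @pi_gt0 R.
  have kN : (k%:R + 1 : R) <= N by rewrite /N -natrX natr1 ler_nat.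
  have k0 : 0 <= k%:R :> R by [].
  rewrite /g.
  have odd_natr (m : nat) : m.*2.+1%:R = 2 * m%:R + 1 :> R.
    by rewrite -addn1 natrD -mul2n natrM.
  set x : R := k.*2.+1%:R * pi / (4 * 2 ^+ n.+1).
  have xE : x = (2 * k%:R + 1) * pi / (8 * N).
    by rewrite /x exprS -/N odd_natr; field; lra.
  have -> : k.*2.+1%:R * pi / (4 * N) = x *+ 2.
    by rewrite mulr2n xE odd_natr; field; lra.
  have -> : ((2 ^ n + 2 ^ n).-1 - k).*2.+1%:R * pi / (4 * 2 ^+ n.+1) = pi / 2 - x.
    rewrite xE exprS -/N odd_natr natrB; last first.
      by have := ltn_ord k; lia.
    rewrite -subn1 natrB; last by have := ltn_ord k; lia.
    by rewrite natrD natrX -/N; field; lra.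
  have -> : sin (pi / 2 - x) = cos x by rewrite sinB sin_pihalf cos_pihalf; ring.
  have s0 : 0 < sin x.
    apply: sin_gt0_pihalf; rewrite xE ltr_pdivlMr ?ltr_pdivrMr; nra.
  have c0 : 0 < cos x.
    apply: cos_gt0_pihalf; rewrite xE ltr_pdivlMr ?ltr_pdivrMr; nra.
  rewrite sin_mulr2n mulr2n.
  have -> : (cos x * sin x + cos x * sin x) ^+ 2 = 4 * (cos x ^+ 2 * sin x ^+ 2).
    by ring.
  have c2 : cos x ^+ 2 != 0 by rewrite expf_neq0 ?gt_eqF.
  have s2 : sin x ^+ 2 != 0 by rewrite expf_neq0 ?gt_eqF.
  have cs := cos2Dsin2 x.
  set u := cos x ^+ 2 in cs c2 *; set v := sin x ^+ 2 in cs s2 *.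
  transitivity ((u + v) / (u * v)); first by field; rewrite ?c2 ?s2.
  by rewrite cs; field; rewrite ?c2 ?s2.
rewrite big_nat_rev/= -{1}(add0n (2 ^ n)%N) big_addn addnK.
by apply: eq_big_nat => k /andP[_ kn]; congr g; lia.
Qed.

(** With [N = 2^n] and angles [x k = (2 k + 1) pi / (4 N)], the sum is [pi^2 / (16 N^2)] times that
    of [1 / (x k)^2]. Replacing each [1 / (x k)^2] by [1 / sin^2 (x k)] costs at most 1 per term,
    hence at most [pi^2 / (16 N)] in all, and the sum over the sines is exactly [2 N^2]. *)
Lemma sum_inv_odd_sqr_bounds {R : realType} (n : nat) :
  pi ^+ 2 / 8 - pi ^+ 2 / (16 * 2 ^+ n) <=
  \sum_(k < 2 ^ n) (k.*2.+1%:R ^+ 2 : R)^-1 <= pi ^+ 2 / 8.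
Proof.
set N : R := 2 ^+ n.
have N0 : 0 < N by rewrite exprn_gt0.
have pi0 := @pi_gt0 R.
pose x (k : nat) : R := k.*2.+1%:R * pi / (4 * N).
have xb (k : 'I_(2 ^ n)) : 0 < x k < pi / 2.
  have kN : (2 * k%:R + 1 : R) < 2 * N.
    by rewrite /N -natrX -natrM natr1 -natrM ltr_nat; have := ltn_ord k; lia.
  have k0 : 0 <= k%:R :> R by [].
  rewrite /x -addn1 natrD -mul2n natrM.
  apply/andP; split; first by rewrite divr_gt0 ?mulr_gt0//; lra.
  by rewrite ltr_pdivrMr; nra.
have xE k : (k.*2.+1%:R ^+ 2 : R)^-1 = pi ^+ 2 / (16 * N ^+ 2) * (x k ^+ 2)^-1.
  have k0 : k.*2.+1%:R != 0 :> R by rewrite pnatr_eq0.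
  by rewrite /x; move: k.*2.+1%:R k0 => m k0; field; rewrite ?k0; lra.
have S := @sum_inv_sin2 R n.
have N2 : N ^+ 2 = 4 ^+ n by rewrite /N exprAC; congr (_ ^+ _); ring.
rewrite -N2 in S.
under eq_bigr do rewrite xE.
rewrite -mulr_sumr.
have c0 : 0 < pi ^+ 2 / (16 * N ^+ 2) by rewrite divr_gt0 ?mulr_gt0 ?exprn_gt0.
apply/andP; split.
  rewrite (_ : _ - _ = pi ^+ 2 / (16 * N ^+ 2) * (2 * N ^+ 2 - N)); last first.
    by field; lra.
  rewrite ler_wpM2l ?(ltW c0)// -S.
  have -> : N = \sum_(k < 2 ^ n) 1 by rewrite sumr_const card_ord natrX.
  rewrite -sumrB; apply: ler_sum => k _.
  by have /inv_sqr_bounds/andP[] := xb k.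
rewrite (_ : pi ^+ 2 / 8 = pi ^+ 2 / (16 * N ^+ 2) * (2 * N ^+ 2)); last first.
  by field; lra.
rewrite ler_wpM2l ?(ltW c0)// -S.
apply: ler_sum => k _.
by have /inv_sqr_bounds/andP[] := xb k.
Qed.

(** The terms at even integers are a quarter of those at all integers, [1 / (2 m)^2] being a quarter
    of [1 / m^2]. *)
Lemma sum_inv_sqr_split {R : realType} (M : nat) :
  \sum_(k < M + M) (k.+1%:R ^+ 2 : R)^-1 =
  \sum_(k < M) (k.*2.+1%:R ^+ 2)^-1 + 4^-1 * \sum_(k < M) (k.+1%:R ^+ 2)^-1.
Proof.
elim: M => [|M IH]; first by rewrite !big_ord0 mulr0 addr0.
rewrite addnS addSn !big_ord_recr/= IH addnn mulrDr.
have -> : M.*2.+2%:R = 2 * M.+1%:R :> R by rewrite -natrM; congr _%:R; lia.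
have M0 : M.+1%:R != 0 :> R by rewrite pnatr_eq0.
have -> : ((2 * M.+1%:R) ^+ 2 : R)^-1 = 4^-1 * (M.+1%:R ^+ 2)^-1.
  by rewrite exprMn invfM; congr (_^-1 * _); ring.
by rewrite !addrA; congr (_ + _); rewrite addrAC.
Qed.

(* With [T n] the partial sums and [S n] those over odd integers,
   [T (2 n) = S n + T n / 4], so [T] tends to [4 / 3] times the limit of [S]. *)
Lemma cvg_sum_inv_sqr {R : realType} :
  (\sum_(k < n) (k.+1%:R ^+ 2 : R)^-1 @[n --> \oo] --> pi ^+ 2 / 6)%classic.
Proof.
pose T (n : nat) : R := \sum_(k < n) (k.+1%:R ^+ 2)^-1.
pose S (n : nat) : R := \sum_(k < n) (k.*2.+1%:R ^+ 2)^-1.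
have ndT : {homo T : m n / (m <= n)%N >-> m <= n}.
  move=> m n mn; rewrite /T -(subnKC mn) big_split_ord/= lerDl.
  by apply: sumr_ge0 => k _; rewrite invr_ge0 exprn_ge0.
have ndS : {homo S : m n / (m <= n)%N >-> m <= n}.
  move=> m n mn; rewrite /S -(subnKC mn) big_split_ord/= lerDl.
  by apply: sumr_ge0 => k _; rewrite invr_ge0 exprn_ge0.
have TS n : T (n + n)%N = S n + 4^-1 * T n by exact: sum_inv_sqr_split.
have Sub n : S n <= pi ^+ 2 / 8.
  have /andP[_] := @sum_inv_odd_sqr_bounds R n; apply: le_trans.
  by apply: ndS; exact/ltnW/ltn_expl.
(* By monotonicity [T n <= T (2 n) = S n + T n / 4], so three quarters of [T n] are at most
   [pi^2 / 8]. *)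
have Tub n : T n <= pi ^+ 2 / 6.
  have := ndT _ _ (leq_addr n n); rewrite TS; have := Sub n; lra.
have pi0 := @pi_gt0 R.
have Tlb n : pi ^+ 2 / 6 - (pi ^+ 2 / 12 + 1) / 2 ^+ n <= T (2 ^ n + 2 ^ n)%N.
  set N : R := 2 ^+ n; have N0 : 0 < N by rewrite exprn_gt0.
  (* The [N] terms between [N] and [2 N] are each at most [1 / N^2]. Hence [T N] in
     [T (2 N) = S N + T N / 4] may be replaced by [T (2 N) - 1 / N], which leaves a lower bound for
     [T (2 N)] alone. *)
  have : T (2 ^ n + 2 ^ n)%N - T (2 ^ n)%N <= N^-1.
    rewrite /T big_split_ord/= [X in X - _]addrC addrK.
    rewrite (_ : N^-1 = \sum_(k < 2 ^ n) (N ^+ 2)^-1); last first.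
      by rewrite sumr_const card_ord -mulr_natl natrX -/N; field; lra.
    apply: ler_sum => k _.
    rewrite lef_pV2 ?posrE ?exprn_gt0// lerXn2r ?nnegrE ?(ltW N0)//.
    by rewrite /N -natrX ler_nat; lia.
  have /andP[+ _] := @sum_inv_odd_sqr_bounds R n.
  rewrite -/(S _) -/N.
  have := TS (2 ^ n)%N.
  have -> : pi ^+ 2 / (16 * N) = pi ^+ 2 / 16 * N^-1 by field; lra.
  have : 0 < N^-1 by rewrite invr_gt0.
  have : 0 < pi ^+ 2 :> R by rewrite exprn_gt0.
  set p := pi ^+ 2; set i := N^-1; nra.
have cT : cvgn T.
  by apply: nondecreasing_is_cvgn => //; exists (pi ^+ 2 / 6) => _ [n _ <-].
suff <- : limn T = pi ^+ 2 / 6 by [].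
apply/eqP; rewrite eq_le; apply/andP; split.
  by apply: limr_le => //; apply: nearW.
apply/ler_addgt0Pr => e e0.
have C0 : 0 < pi ^+ 2 / 12 + 1 :> R by rewrite ltr_wpDl// divr_ge0 ?exprn_ge0 ?ltW.
have [n nP] : exists n, (pi ^+ 2 / 12 + 1) / e < n%:R.
  by eexists; apply: archi_boundP; rewrite divr_ge0// ltW.
have : (pi ^+ 2 / 12 + 1) / 2 ^+ n <= e.
  rewrite ler_pdivrMr ?exprn_gt0// [e * _]mulrC -ler_pdivrMr//.
  apply: (le_trans (ltW nP)).
  by rewrite -natrX ler_nat ltnW// ltn_expl.
have := Tlb n.
have := nondecreasing_cvgn_le ndT cT (2 ^ n + 2 ^ n)%N.
lra.
Qed.

(** * Arc-length distance and the kernel [h] in terms of angles *)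

(** This is the distance from [u] to the nearest multiple of [2 pi]. *)
Definition circdist {R : realType} (u : R) : R := acos (cos u).

Lemma cos_itv {R : realType} (u : R) : -1 <= cos u <= 1.
Proof. by rewrite cos_geN1 cos_le1. Qed.

Lemma circdist_itv {R : realType} (u : R) : 0 <= circdist u <= pi.
Proof. by rewrite acos_ge0 ?acos_lepi ?cos_itv. Qed.

Lemma cos_circdist {R : realType} (u : R) : cos (circdist u) = cos u.
Proof. by rewrite acosK// in_itv/= cos_itv. Qed.

Lemma circdist_id {R : realType} (u : R) : 0 <= u <= pi -> circdist u = u.
Proof. by move=> u0; rewrite /circdist cosK// in_itv. Qed.

Lemma circdistN {R : realType} (u : R) : circdist (- u) = circdist u.
Proof. by rewrite /circdist cosN. Qed.

Lemma circdist_norm {R : realType} (u : R) : `|u| <= pi -> circdist u = `|u|.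
Proof. by move=> upi; rewrite /circdist -cos_norm -/(circdist _) circdist_id ?normr_ge0. Qed.

Lemma circdistD2pi {R : realType} (u : R) : circdist (u + pi *+ 2) = circdist u.
Proof. by rewrite /circdist cosD2pi. Qed.

Lemma circdistDpi {R : realType} (u : R) : `|u| <= pi -> circdist (pi + u) = pi - `|u|.
Proof.
move=> upi; rewrite -(@circdist_id _ (pi - `|u|)) ?subr_ge0 ?upi ?gerBl ?normr_ge0//.
by rewrite /circdist [pi + u]addrC cosDpi -cos_norm cosB cospi sinpi mul0r addr0 mulN1r.
Qed.

Lemma geodist_circle_pt {R : realType} (s t : R) :
  geodist (circle_pt s) (circle_pt t) = circdist (s - t).
Proof. by rewrite /geodist /circdist cosB. Qed.

(** The angle [acos a] has the right cosine, and its sine is right up to sign, which [- acos a]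
    corrects. *)
Lemma S1_circle_pt {R : realType} (x : R * R) :
  S1 x -> exists t, x = circle_pt t.
Proof.
case: x => a b; rewrite /S1/= => ab.
have b2 := sqr_ge0 b.
have ai : -1 <= a <= 1 by apply/andP; split; nra.
have cK : cos (acos a) = a by rewrite acosK// in_itv.
have : b ^+ 2 = sin (acos a) ^+ 2 by rewrite sin2cos2 cK -ab; ring.
move/eqP; rewrite eqf_sqr => /orP[]/eqP bE.
  by exists (acos a); rewrite /circle_pt cK bE.
by exists (- acos a); rewrite /circle_pt cosN sinN cK bE.
Qed.

(* When a denominator distance vanishes, Rocq's division by zero gives the value
   [0] prescribed by the indicator. *)
Lemma msd_h_circle_pt {R : realType} (a b c : R) :
  msd_h geodist (circle_pt a) (circle_pt b) (circle_pt c) =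
  (circdist (a - c) ^+ 2 + circdist (b - c) ^+ 2 - circdist (a - b) ^+ 2) /
    (circdist (a - c) * circdist (b - c)).
Proof.
rewrite /msd_h !geodist_circle_pt.
have d0 (s : R) : circle_pt c = circle_pt s -> circdist (s - c) = 0 :> R.
  by rewrite -geodist_circle_pt /geodist => <-/=; rewrite -!expr2 cos2Dsin2 acos1.
case: ifPn => // /orP[]/eqP/d0 ->.
  by rewrite mul0r invr0 mulr0.
by rewrite mulr0 invr0 mulr0.
Qed.

(* The points at distances [circdist u] and [circdist v] from the origin lie on
   the same half circle or on opposite ones. *)
Lemma circdistB_cases {R : realType} (u v : R) :
  circdist (u - v) = circdist (circdist u - circdist v) \/
  circdist (u - v) = circdist (circdist u + circdist v).
Proof.
(* Equal cosines leave only the signs of the sines open. In the cosine of [u - v], two equal signs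
   give the difference of the distances and two different signs give their sum. *)
have sE (w : R) : (sin w == sin (circdist w)) || (sin w == - sin (circdist w)).
  by rewrite -eqf_sqr !sin2cos2 cos_circdist.
rewrite /circdist cosB cosB cosD -!/(circdist _) !cos_circdist.
case/orP: (sE u) => /eqP ->; case/orP: (sE v) => /eqP ->;
  rewrite ?mulrNN ?mulNr ?mulrN; by [left|right].
Qed.

(** If [u], [v] are the distances to the third point and [w] the distance between the first two,
    then [|u - v| <= w <= u + v], so [u^2 + v^2 - w^2] lies between [- 2 u v] and [2 u v]. *)
Lemma norm_msd_h_circle_pt {R : realType} (a b c : R) :
  `|msd_h geodist (circle_pt a) (circle_pt b) (circle_pt c)| <= 2.
Proof.
rewrite msd_h_circle_pt.
have -> : a - b = (a - c) - (b - c) by ring.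
have := circdistB_cases (a - c) (b - c).
have := circdist_itv (a - c); have := circdist_itv (b - c).
move: (circdist (a - c - (b - c))) (circdist (a - c)) (circdist (b - c)) => w u v.
move=> /andP[v0 vpi] /andP[u0 upi] wE.
have [->|u0'] := eqVneq u 0; first by rewrite mul0r invr0 mulr0 normr0.
have [->|v0'] := eqVneq v 0; first by rewrite mulr0 invr0 mulr0 normr0.
have up : 0 < u by rewrite lt0r u0'.
have vp : 0 < v by rewrite lt0r v0'.
have uv : 0 < u * v by rewrite mulr_gt0.
rewrite normrM normfV (gtr0_norm uv) ler_pdivrMr//.
rewrite ler_norml.
case: wE => ->.
  rewrite circdist_norm ?real_normK ?num_real// ?ler_norml; last by apply/andP; split; lra.
  by apply/andP; split; nra.
(* For points on opposite half circles, the arc through the third point has length [u + v]; beyond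
   [pi] the shorter arc is the complementary one, of length [2 pi - u - v]. *)
have [uvpi|uvpi] := leP (u + v) pi.
  rewrite circdist_id ?uvpi ?addr_ge0//.
  by apply/andP; split; nra.
rewrite (_ : u + v = pi + (u + v - pi)); last by ring.
rewrite circdistDpi ger0_norm; [|lra..].
by apply/andP; split; nra.
Qed.

(** Both points lie on the same half circle from [c], at distances [pi - s] and [b], so their mutual
    distance is [|pi - s - b|] and the numerator is twice the denominator. *)
Lemma msd_h_same_side {R : realType} (c s b : R) : 0 < s < pi -> 0 < b < pi ->
  msd_h geodist (circle_pt (c + pi + s)) (circle_pt (c - b)) (circle_pt c) = 2 /\
  msd_h geodist (circle_pt (c + pi - s)) (circle_pt (c + b)) (circle_pt c) = 2.
Proof.
move=> /andP[s0 spi] /andP[b0 bpi].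
have bn : b != 0 by rewrite gt_eqF.
have sn : pi - s != 0 by rewrite subr_eq0 gt_eqF.
rewrite !msd_h_circle_pt.
have -> : c + pi + s - c = pi + s by ring.
have -> : c + pi - s - c = pi + - s by ring.
have -> : c - b - c = - b by ring.
have -> : c + b - c = b by ring.
have -> : c + pi + s - (c - b) = (s + b - pi) + pi *+ 2 by rewrite mulr2n; ring.
have -> : c + pi - s - (c + b) = - (s + b - pi) by ring.
rewrite !circdistN circdistD2pi !circdistDpi ?normrN ?gtr0_norm; try lra.
rewrite !(@circdist_id _ b); last lra.
rewrite circdist_norm ?real_normK ?num_real ?ler_norml//; last by apply/andP; split; lra.
by move: (pi : R) sn => p sn; split; field; rewrite bn sn.
Qed.

(** The arc between the points through [c] has length [pi - s + b]. If [b <= s] it is a shortest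
    arc, the distances to [c] add up and [h = -2]; otherwise the distance is that of the other arc,
    [pi + s - b]. *)
Lemma msd_h_opposite_sides {R : realType} (c s b : R) :
  0 < s < pi -> 0 < b < pi ->
  let g := if s < b then 4 * pi * (b - s) / ((pi - s) * b) - 2 else - 2 in
  msd_h geodist (circle_pt (c + pi + s)) (circle_pt (c + b)) (circle_pt c) = g /\
  msd_h geodist (circle_pt (c + pi - s)) (circle_pt (c - b)) (circle_pt c) = g.
Proof.
move=> /andP[s0 spi] /andP[b0 bpi] g.
have bn : b != 0 by rewrite gt_eqF.
have sn : pi - s != 0 by rewrite subr_eq0 gt_eqF.
rewrite !msd_h_circle_pt.
have -> : c + pi + s - c = pi + s by ring.
have -> : c + pi - s - c = pi + - s by ring.
have -> : c - b - c = - b by ring.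
have -> : c + b - c = b by ring.
have -> : c + pi + s - (c + b) = pi + (s - b) by ring.
have -> : c + pi - s - (c - b) = pi + - (s - b) by ring.
have sb : `|s - b| <= pi by rewrite ler_norml; apply/andP; split; lra.
rewrite !circdistN !circdistDpi ?normrN ?(gtr0_norm s0)//; try lra.
rewrite !(@circdist_id _ b); last lra.
rewrite /g; case: ltP => sb'.
  by rewrite ltr0_norm; [move: (pi : R) sn => p sn; split; field; rewrite bn sn|lra].
by rewrite ger0_norm; [move: (pi : R) sn => p sn; split; field; rewrite bn sn|lra].
Qed.

(** * Measurability of the distance and of the kernel *)

Lemma measurable_circdist {R : realType} : measurable_fun [set: R] (@circdist R).
Proof.
(* Clamping the argument to [[-1, 1]] makes [acos] nonincreasing on the whole line, hence
   measurable, and changes nothing at values of [cos]. *)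
pose F (y : R) := acos (Num.max (-1) (Num.min 1 y)).
rewrite (_ : circdist = F \o cos); last first.
  by apply/funext => u /=; rewrite /F min_r ?max_r ?cos_geN1 ?cos_le1.
apply: measurableT_comp; last first.
  by apply: continuous_measurable_fun; exact: continuous_cos.
apply: nonincreasing_measurable => // x y xy.
have Fi z : Num.max (-1) (Num.min 1 z) \in `[(-1 : R), 1].
  by rewrite in_itv/= le_max lexx/= ge_max ge_min lexx/= andbT; lra.
have bnd z : acos (Num.max (-1) (Num.min 1 z)) \in `[0, (pi : R)].
  by have := Fi z; rewrite !in_itv/= => zi; rewrite acos_ge0 ?acos_lepi.
rewrite leNgt; apply/negP; rewrite -(ltr_cos (bnd x) (bnd y)) !acosK//.
apply/negP; rewrite -leNgt ge_max !le_max lexx/=.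
by rewrite le_min !ge_min lexx/= xy !orbT.
Qed.

Lemma measurable_msd_h_circle_pt {R : realType} (c : R) :
  measurable_fun [set: R * R]
    (fun z => msd_h geodist (circle_pt z.1) (circle_pt z.2) (circle_pt c)).
Proof.
(* The quotient becomes a product with the power [-1] of the nonnegative denominator, a measurable
   function that also takes the value 0 at 0. *)
rewrite (_ : (fun z => _) = fun z : R * R =>
  (circdist (z.1 - c) ^+ 2 + circdist (z.2 - c) ^+ 2 - circdist (z.1 - z.2) ^+ 2) *
    (circdist (z.1 - c) * circdist (z.2 - c)) `^ (-1)); last first.
  apply/funext => z; rewrite msd_h_circle_pt powR_inv1//.
  by rewrite mulr_ge0//; [case/andP: (circdist_itv (z.1 - c))|case/andP: (circdist_itv (z.2 - c))].
have md (f : R * R -> R) : measurable_fun setT f ->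
    measurable_fun setT (fun z => circdist (f z)).
  exact: measurableT_comp measurable_circdist.
have m1 : measurable_fun setT (fun z : R * R => circdist (z.1 - c)).
  apply: md; apply: measurable_funB; [exact: measurable_fst|exact: measurable_cst].
have m2 : measurable_fun setT (fun z : R * R => circdist (z.2 - c)).
  apply: md; apply: measurable_funB; [exact: measurable_snd|exact: measurable_cst].
have m12 : measurable_fun setT (fun z : R * R => circdist (z.1 - z.2)).
  apply: md; apply: measurable_funB; [exact: measurable_fst|exact: measurable_snd].
have num := measurable_funB (measurable_funD (measurable_funX 2 m1)
  (measurable_funX 2 m2)) (measurable_funX 2 m12).
have den := measurableT_comp (@measurable_powR R (-1)) (measurable_funM m1 m2).
exact: measurable_funM num den.
Qed.

(** * Translation, reflection, periodicity and folding of integrals *)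

(** The translated measure gives half-open intervals their length, and this determines Lebesgue
    measure. *)
Lemma lebesgue_measureD {R : realType} (c : R) (A : set R) : measurable A ->
  pushforward lebesgue_measure (fun x : measurableTypeR R => x + c : measurableTypeR R) A =
  lebesgue_measure A.
Proof.
have mD : measurable_fun setT (fun x : measurableTypeR R => x + c : measurableTypeR R).
  by apply: measurable_funD; [exact: measurable_id|exact: measurable_cst].
move=> mA; apply/esym/lebesgue_measure_unique => //= _ [[a b]] _ <-.
rewrite /pushforward/= (_ : (_ @^-1` _ = `]a - c, b - c])%classic); last first.
  by apply/seteqP; split => x /=; rewrite !in_itv/= ltrBlDr lerBrDr.
by rewrite !lebesgue_measure_itv/= !lte_fin ltrD2r -!EFinD; case: ifP => // _; congr EFin; ring.
Qed.

Lemma ge0_integral_shift {R : realType} (f : R -> \bar R) (c a b : R) :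
  measurable_fun setT f -> (forall x, 0 <= f x)%E ->
  (\int[lebesgue_measure]_(x in `[a, b]) f (x + c)%R =
   \int[lebesgue_measure]_(x in `[(a + c)%R, (b + c)%R]) f x)%E.
Proof.
move=> mf f0.
rewrite (_ : `[a, b]%classic =
    ((fun x : measurableTypeR R => x + c : measurableTypeR R)
      @^-1` `[a + c, b + c])%classic); last first.
  by apply/seteqP; split => x /=; rewrite !in_itv/= !lerD2r.
have mD : measurable_fun setT
    (fun x : measurableTypeR R => x + c : measurableTypeR R).
  by apply: measurable_funD; [exact: measurable_id|exact: measurable_cst].
rewrite -(ge0_integral_pushforward mD lebesgue_measure)//=.
  by apply: eq_measure_integral => //= A mA AS; exact: lebesgue_measureD.
exact: measurable_funS mf.
Qed.

Lemma ge0_integral_opp {R : realType} (f : R -> \bar R) (a b : R) :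
  measurable_fun setT f -> (forall x, 0 <= f x)%E ->
  (\int[lebesgue_measure]_(x in `[a, b]) f (- x)%R =
   \int[lebesgue_measure]_(x in `[(- b)%R, (- a)%R]) f x)%E.
Proof.
move=> mf f0.
rewrite (_ : `[a, b]%classic = ((-%R : _ -> measurableTypeR R) @^-1` `[- b, - a])%classic);
    last first.
  by apply/seteqP; split => x /=; rewrite !in_itv/= !lerN2 andbC.
rewrite -(@ge0_integral_pushforward _ _ _ _ _ _ _ lebesgue_measure)//=.
- by apply: eq_measure_integral => //= A mA AS; exact: lebesgue_measureN.
- exact: measurable_funS mf.
Qed.

Lemma ge0_integral_itv_cat {R : realType} (f : R -> \bar R) (a b c : R) :
  measurable_fun setT f -> (forall x, 0 <= f x)%E -> a <= b <= c ->
  (\int[lebesgue_measure]_(x in `[a, c]) f x =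
   \int[lebesgue_measure]_(x in `[a, b]) f x +
   \int[lebesgue_measure]_(x in `[b, c]) f x)%E.
Proof.
move=> mf f0 /andP[ab bc].
rewrite -(@integral_itv_obnd_cbnd _ b); last exact: measurable_funS mf.
rewrite -ge0_integral_setU//=.
- congr (integral _ _ _); apply/seteqP; split => x /=; rewrite !in_itv/=.
    by move=> /andP[ax xc]; case: (leP x b) => xb; [left|right]; apply/andP.
  by move=> [] /andP[h1 h2]; apply/andP; split; lra.
- exact: measurable_funS mf.
- apply/disj_setPS => x []/=; rewrite !in_itv/= => /andP[_ h] /andP[h' _]; lra.
Qed.

(** Subtracting a multiple of [T] brings the left end to some [d] in [[0, T]]; the part of
    [[d, d + T]] beyond [T] is then a translate of the missing part [[0, d]]. *)
Lemma ge0_integral_periodic {R : realType} (f : R -> \bar R) (T c : R) :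
  measurable_fun setT f -> (forall x, 0 <= f x)%E -> 0 < T ->
  (forall x, f (x + T) = f x) ->
  (\int[lebesgue_measure]_(x in `[c, (c + T)%R]) f x =
   \int[lebesgue_measure]_(x in `[0%R, T]) f x)%E.
Proof.
move=> mf f0 T0 fT.
have fTn (n : nat) x : f (x + T *+ n) = f x.
  by elim: n => [|n IH]; rewrite ?mulr0n ?addr0// mulrSr addrA fT.
have fTz (k : int) x : f (x + T *~ k) = f x.
  case: k => n; first by rewrite -pmulrn fTn.
  by rewrite -(fTn n.+1) NegzE mulrNz -pmulrn addrNK.
have base d : 0 <= d <= T ->
    (\int[lebesgue_measure]_(x in `[d, (d + T)%R]) f x =
     \int[lebesgue_measure]_(x in `[0%R, T]) f x)%E.
  move=> /andP[d0 dT].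
  rewrite (@ge0_integral_itv_cat _ _ d T)//; last by rewrite dT lerDr.
  rewrite (@ge0_integral_itv_cat _ _ 0 d T)//; last by rewrite d0.
  rewrite addeC; congr (_ + _)%E.
  rewrite -{1}(add0r T) -ge0_integral_shift//.
  by apply: eq_integral => x _; rewrite fT.
pose k := Num.floor (c / T).
pose d := c - T *~ k.
have dT : 0 <= d <= T.
  rewrite /d -mulrzr; have /andP[h1 h2] := floor_itv (c / T).
  rewrite ler_pdivlMr// in h1; rewrite ltr_pdivrMr// intrD1 in h2.
  by rewrite -/k in h1 h2; apply/andP; split; nra.
have -> : c + T = (d + T) + T *~ k by rewrite /d; ring.
have -> : c = d + T *~ k by rewrite subrK.
rewrite -(base _ dT) -ge0_integral_shift//.
by apply: eq_integral => x _; rewrite fTz.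
Qed.

Lemma ge0_integral_fold {R : realType} (f : R -> \bar R) (c h : R) :
  measurable_fun setT f -> (forall x, 0 <= f x)%E -> 0 <= h ->
  (\int[lebesgue_measure]_(x in `[(c - h)%R, (c + h)%R]) f x =
   \int[lebesgue_measure]_(u in `[0%R, h]) (f (c + u)%R + f (c - u)%R))%E.
Proof.
move=> mf f0 h0.
have m1 : measurable_fun setT (fun u : R => f (c + u)).
  apply: (measurableT_comp mf); apply: measurable_funD => //; exact: measurable_cst.
have m2 : measurable_fun setT (fun u : R => f (c - u)).
  apply: (measurableT_comp mf); apply: measurable_funB => //; exact: measurable_cst.
rewrite ge0_integralD//; [|exact: measurable_funS m1|exact: measurable_funS m2].
rewrite (@ge0_integral_itv_cat _ _ _ c)//; last by rewrite gerBl h0 lerDl.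
rewrite addeC; congr (_ + _)%E.
  rewrite -{1}(add0r c) [c + h]addrC -ge0_integral_shift//.
  by apply: eq_integral => x _; rewrite addrC.
rewrite -[X in `[_, X]](add0r c) [c - h]addrC -ge0_integral_shift//.
rewrite -[X in `[_, X]]oppr0 -(@ge0_integral_opp _ (fun x => f (x + c))%R)//.
  by apply: eq_integral => x _; rewrite addrC.
by apply: (measurableT_comp mf); apply: measurable_funD => //; exact: measurable_cst.
Qed.

(** * The telescoping series and integrals of monomials *)

Lemma nneseries_EFin_cvg {R : realType} (u : nat -> R) (l : R) :
  (series u x @[x --> \oo] --> l)%classic ->
  (\sum_(0 <= n <oo) (u n)%:E = l%:E)%E.
Proof.
move=> ul; apply/cvg_lim => //.
rewrite (_ : (fun n => _) = EFin \o series u); last first.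
  by apply/funext => n /=; rewrite sumEFin.
by apply: cvg_EFin => //; exact: nearW.
Qed.

(** With [m = n + 1], the term is [1 / m - 1 / (m + 1) - 1 / (m + 1)^2]: the first two parts
    telescope and the last leaves the sum of inverse squares without its first term. *)
Lemma cvg_sum_inv_mul_sqr {R : realType} :
  (series (fun n => (n.+1%:R * n.+2%:R ^+ 2 : R)^-1) x @[x --> \oo]
    --> 2 - pi ^+ 2 / 6)%classic.
Proof.
pose T (n : nat) : R := \sum_(k < n) (k.+1%:R ^+ 2)^-1.
have E n : series (fun n => (n.+1%:R * n.+2%:R ^+ 2 : R)^-1) n =
    2 - (n.+1%:R)^-1 - T n.+1.
  rewrite /series/=; elim: n => [|n IH].
    by rewrite big_geq// /T big_ord1/= expr1n invr1; ring.
  rewrite big_nat_recr//= IH /T [in RHS]big_ord_recr/=.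
  have -> : n.+2%:R = n.+1%:R + 1 :> R by rewrite natr1.
  have m0 : n.+1%:R != 0 :> R by rewrite pnatr_eq0.
  have m1 : n.+1%:R + 1 != 0 :> R by rewrite natr1 pnatr_eq0.
  move: n.+1%:R m0 m1 (\sum_(i < n.+1) _) => m m0 m1 t.
  by field; rewrite m0 m1.
rewrite (_ : series _ = fun n => 2 - (n.+1%:R)^-1 - T n.+1); last exact/funext.
rewrite -[X in (_ --> X - _)%classic]subr0.
apply: cvgB.
  by apply: cvgB; [exact: cvg_cst|exact: cvg_harmonic].
by have := @cvg_sum_inv_sqr R; rewrite -cvg_shiftS.
Qed.

Lemma integral_horner_deriv {R : realType} (p : {poly R}) (a b : R) : a < b ->
  (\int[lebesgue_measure]_(x in `[a, b]) (p^`()%R.[x])%R%:E =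
   (p.[b] - p.[a])%R%:E)%E.
Proof.
move=> ab; rewrite (continuous_FTC2 (F := horner p) ab) ?EFinB//.
- by apply: continuous_subspaceT => x; exact: continuous_horner.
- split; first by move=> x _; exact: derivable_horner.
  + by apply: cvg_at_right_filter; exact: continuous_horner.
  + by apply: cvg_at_left_filter; exact: continuous_horner.
- by move=> x _; rewrite -derivE.
Qed.

Lemma integral_exprn_itv {R : realType} (n : nat) (b : R) : 0 < b ->
  (\int[lebesgue_measure]_(x in `[0%R, b]) (x ^+ n)%:E =
   (b ^+ n.+1 / n.+1%:R)%:E)%E.
Proof.
move=> b0; pose p : {poly R} := n.+1%:R^-1 *: 'X^(n.+1).
have n0 : n.+1%:R != 0 :> R by rewrite pnatr_eq0.
rewrite (_ : b ^+ n.+1 / _ = p.[b] - p.[0]); last first.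
  by rewrite /p !hornerE/= expr0n/= mulr0 subr0 mulrC.
rewrite -integral_horner_deriv//; apply: eq_integral => x _; congr EFin.
by rewrite /p derivZ derivXn !hornerE/= hornerMn hornerXn -[_ ^+ n *+ _]mulr_natl mulKf.
Qed.

(** The positive part of [b - s] encodes the vanishing for [s >= b], and [|s|] keeps the integrand
    nonnegative on the whole line. On [[0, b]] the integrand is the polynomial
    [b s^n - s^(n + 1)]. *)
Lemma integral_exprn_mul_maxB {R : realType} (n : nat) (b c : R) : 0 < b <= c ->
  (\int[lebesgue_measure]_(s in `[0%R, c]) (`|s| ^+ n * Num.max (b - s) 0)%R%:E =
   (b ^+ n.+2 / (n.+1%:R * n.+2%:R))%:E)%E.
Proof.
move=> /andP[b0 bc].
have mf : measurable_fun setT (fun s : R => (`|s| ^+ n * Num.max (b - s) 0)%R%:E).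
  apply/measurable_EFinP; apply: measurable_funM.
    by apply: measurable_funX; exact: normr_measurable.
  apply: measurable_maxr; last exact: measurable_cst.
  by apply: measurable_funB; [exact: measurable_cst|exact: measurable_id].
rewrite (@ge0_integral_itv_cat _ _ _ b)//; [|by move=> x; rewrite lee_fin mulr_ge0// le_max lexx orbT|by rewrite ltW].
rewrite [X in (_ + X)%E]integral0_eq ?adde0; last first.
  move=> x /=; rewrite in_itv/= => /andP[bx _].
  by rewrite max_r ?mulr0// subr_le0.
pose p : {poly R} := (b / n.+1%:R) *: 'X^(n.+1) - n.+2%:R^-1 *: 'X^(n.+2).
have n0 : n.+1%:R != 0 :> R by rewrite pnatr_eq0.
have n1 : n.+1%:R + 1 != 0 :> R by rewrite natr1 pnatr_eq0.
have nE : n.+2%:R = n.+1%:R + 1 :> R by rewrite natr1.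
rewrite (_ : b ^+ n.+2 / _ = p.[b] - p.[0]); last first.
  have pE y : p.[y] = b / n.+1%:R * y ^+ n.+1 - n.+2%:R^-1 * y ^+ n.+2.
    by rewrite /p hornerD hornerN !hornerZ !hornerXn.
  rewrite !pE !expr0n/= !mulr0 !subr0 [b ^+ n.+2]exprS nE.
  by move: n.+1%:R n0 n1 (b ^+ n.+1) => m n0 n1 t; field; rewrite n0 n1.
rewrite -integral_horner_deriv//; apply: eq_integral => x.
rewrite inE/= in_itv/= => /andP[x0 xb]; congr EFin.
rewrite ger0_norm// max_l ?subr_ge0//.
rewrite /p derivB !derivZ !derivXn hornerD hornerN !hornerZ !hornerMn !hornerXn -[_ ^+ n *+ _]mulr_natl -[_ ^+ n.+1 *+ _]mulr_natl exprS nE.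
by move: n.+1%:R n0 n1 (x ^+ n) => m n0 n1 t; field; rewrite n0 n1.
Qed.

(** Sum and integral are exchanged by monotone convergence, the terms being nonnegative on
    [[a, b]]. *)
Lemma ge0_integral_cst_series {R : realType} (t : nat -> R -> R) (C a b : R) :
  0 <= C -> a <= b -> (forall n, measurable_fun setT (t n)) ->
  (forall n x, a <= x <= b -> 0 <= t n x) ->
  (\int[lebesgue_measure]_(x in `[a, b]) (C%:E + \sum_(0 <= n <oo) (t n x)%:E) =
   (C * (b - a))%:E + \sum_(0 <= n <oo)
     \int[lebesgue_measure]_(x in `[a, b]) (t n x)%:E)%E.
Proof.
move=> C0 ab mt t0.
have mt' n : measurable_fun `[a, b]%classic (fun x => (t n x)%:E).
  by apply/measurable_EFinP; exact: measurable_funS (mt n).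
have t0' n x : `[a, b]%classic x -> (0 <= (t n x)%:E)%E.
  by rewrite /= in_itv/= lee_fin => /t0.
rewrite ge0_integralD//=; last 2 first.
- by move=> x xab; apply: nneseries_ge0 => n _ _; exact: t0'.
- have := @ge0_emeasurable_sum _ _ R `[a, b]%classic (fun n x => (t n x)%:E) xpredT.
  by apply => // n x xab _; exact: t0'.
rewrite integral_nneseries//; congr (_ + _)%E.
have := integral_cst (@lebesgue_measure R) (measurable_itv `[a, b]) C%:E.
rewrite /cst => ->.
have mab : lebesgue_measure (`[a, b]%classic : set R) = (b - a)%:E.
  rewrite lebesgue_measure_itv/= lte_fin.
  by case: ltP => [_|ba]; [rewrite EFinB|rewrite (_ : b - a = 0)//; lra].
by rewrite EFinM; congr (_ * _)%E; exact: mab.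
Qed.

(** * The mean of [h + 2] over two independent uniform points *)

Lemma circle_ptD2pi {R : realType} (t : R) : circle_pt (t + 2 * pi) = circle_pt t.
Proof. by rewrite /circle_pt mulr_natl cosD2pi sinD2pi. Qed.

(** By periodicity the interval of angles may be centred at any [c]; folding [[c - pi, c + pi]]
    about [c] pairs the two points at the same distance from it. *)
Lemma integral_unif_angle_fold {R : realType} (f : R -> \bar R) (c : R) :
  measurable_fun setT f -> (forall x, 0 <= f x)%E ->
  (forall x, f (x + 2 * pi) = f x) ->
  (\int[unif_angle]_x f x = ((2 * pi)^-1)%:E *
   \int[lebesgue_measure]_(u in `[0%R, pi]) (f (c + u)%R + f (c - u)%R))%E.
Proof.
move=> mf f0 fper.
rewrite /unif_angle integral_uniform// subr0; congr (_ * _)%E.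
have pi0 : 0 < 2 * pi :> R by rewrite mulr_gt0 ?pi_gt0.
rewrite -(@ge0_integral_periodic _ _ (2 * pi) (c - pi))//.
have -> : c - pi + 2 * pi = c + pi by ring.
by rewrite ge0_integral_fold ?pi_ge0.
Qed.

(** Of the two points at distance [s] from the antipode, one lies on the side of the second point
    and contributes 4; the other contributes a geometric series of ratio [s / pi]. Hence the sum is
    the same for both signs of [b]. *)
Lemma msd_hD2_fold {R : realType} (c s b : R) : 0 < s < pi -> 0 < b < pi ->
  let k x y := (msd_h geodist (circle_pt x) (circle_pt y) (circle_pt c) + 2)%:E in
  let v := (4%:E + \sum_(0 <= n <oo)
    (4 / (pi ^+ n * b) * (`|s| ^+ n * Num.max (b - s) 0))%R%:E)%E in
  (k (c + pi + s)%R (c + b)%R + k (c + pi - s)%R (c + b)%R)%E = v /\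
  (k (c + pi + s)%R (c - b)%R + k (c + pi - s)%R (c - b)%R)%E = v.
Proof.
move=> s0pi b0pi k v.
have [s0 spi] := andP s0pi; have [b0 bpi] := andP b0pi.
have pi0 := @pi_gt0 R.
have sp : `|s / pi| < 1 by rewrite ger0_norm ?divr_ge0 ?ltW// ltr_pdivrMr ?mul1r.
have -> : v = (4 + (4 * Num.max (b - s) 0 / b) / (1 - s / pi))%:E.
  rewrite EFinD; congr (_ + _)%E; apply: nneseries_EFin_cvg.
  rewrite (_ : (fun n : nat => 4 / _ * _) = geometric (4 * Num.max (b - s) 0 / b) (s / pi)).
    exact: cvg_geometric_series.
  apply/funext => n; rewrite /= ger0_norm ?(ltW s0)// expr_div_n invfM.
  ring.
have [e1 e2] := msd_h_same_side c _ _ s0pi b0pi.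
have [e3 e4] := msd_h_opposite_sides c _ _ s0pi b0pi.
have pn : pi != 0 :> R by rewrite gt_eqF.
have bn : b != 0 by rewrite gt_eqF.
have sn : pi - s != 0 by rewrite subr_eq0 gt_eqF.
have g : 4 * Num.max (b - s) 0 / b / (1 - s / pi) =
    (if s < b then 4 * pi * (b - s) / ((pi - s) * b) - 2 else - 2) + 2.
  case: ltP => sb.
    rewrite max_l ?subr_ge0 ?ltW// subrK.
    by move: (pi : R) pn sn => p pn sn; field; rewrite pn bn sn.
  by rewrite max_r ?subr_le0// mulr0 !mul0r addNr.
rewrite /k -!EFinD e1 e2 e3 e4 g.
by split; congr EFin; ring.
Qed.

Lemma integral_msd_hD2_arc {R : realType} (c b : R) : 0 < b < pi ->
  let k x y := (msd_h geodist (circle_pt x) (circle_pt y) (circle_pt c) + 2)%:E in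
  let v := (2%:E + \sum_(0 <= n <oo)
    (2 / (pi ^+ n.+1 * (n.+1%:R * n.+2%:R)) * b ^+ n.+1)%R%:E)%E in
  (\int[unif_angle]_x k x (c + b)%R = v)%E /\
  (\int[unif_angle]_x k x (c - b)%R = v)%E.
Proof.
move=> b0pi k v.
have [b0 bpi] := andP b0pi.
have pi0 := @pi_gt0 R.
have pn : pi != 0 :> R by rewrite gt_eqF.
have bn : b != 0 by rewrite gt_eqF.
pose t n (s : R) := 4 / (pi ^+ n * b) * (`|s| ^+ n * Num.max (b - s) 0).
have t0 n s : 0 <= t n s.
  have p0 : 0 <= pi ^+ n * b by rewrite mulr_ge0 ?exprn_ge0 ?pi_ge0 ?(ltW b0).
  by rewrite mulr_ge0 ?divr_ge0// mulr_ge0 ?exprn_ge0// le_max lexx orbT.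
have mt n : measurable_fun setT (t n).
  apply: measurable_funM; first exact: measurable_cst.
  apply: measurable_funM.
    by apply: measurable_funX; exact: normr_measurable.
  apply: measurable_maxr; last exact: measurable_cst.
  by apply: measurable_funB; [exact: measurable_cst|exact: measurable_id].
have vE : (v = ((2 * pi)^-1)%:E * \int[lebesgue_measure]_(s in `[0%R, pi])
    (4%:E + \sum_(0 <= n <oo) (t n s)%:E))%E.
  rewrite ge0_integral_cst_series ?(ltW pi0)//.
  rewrite ge0_muleDr; last 2 first.
  - by rewrite lee_fin mulr_ge0 ?subr0 ?pi_ge0.
  - by apply: nneseries_ge0 => n _ _; apply: integral_ge0 => s _; rewrite lee_fin t0.
  rewrite -EFinM -nneseriesZl; last first.
    by move=> n _; apply: integral_ge0 => s _; rewrite lee_fin t0.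
  congr (_ + _)%E.
    by congr EFin; rewrite subr0; move: (pi : R) pn => p pn; field.
  apply: eq_eseriesr => n _.
  under eq_integral do rewrite EFinM.
  rewrite ge0_integralZl_EFin//; last 3 first.
  - by move=> s _; rewrite lee_fin mulr_ge0 ?exprn_ge0// le_max lexx orbT.
  - apply/measurable_EFinP; apply: measurable_funM.
      by apply: measurable_funX; exact: normr_measurable.
    apply: measurable_maxr; last exact: measurable_cst.
    by apply: measurable_funB; [exact: measurable_cst|exact: measurable_id].
  - by rewrite divr_ge0// mulr_ge0 ?exprn_ge0 ?pi_ge0 ?(ltW b0).
  rewrite integral_exprn_mul_maxB ?b0 ?(ltW bpi)// -!EFinM; congr EFin.
  have pX : pi ^+ n != 0 :> R by rewrite expf_neq0.
  have n1 : n.+1%:R != 0 :> R by rewrite pnatr_eq0.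
  have n2 : n.+2%:R != 0 :> R by rewrite pnatr_eq0.
  rewrite [b ^+ n.+2]exprS [pi ^+ n.+1]exprS.
  move: (pi : R) pn (pi ^+ n) pX n.+1%:R n1 n.+2%:R n2 (b ^+ n.+1).
  move=> p pn p' pX m n1 m' n2 b'.
  by field; rewrite pn pX bn n1 n2.
have mG : measurable_fun `]0, pi[%classic
    (fun s => 4%:E + \sum_(0 <= n <oo) (t n s)%:E)%E.
  apply: measurable_funS (measurableT) (@subsetT _ _) _.
  apply: emeasurable_funD; first exact: measurable_cst.
  apply: (@ge0_emeasurable_sum _ _ R setT (fun n x => (t n x)%:E) xpredT).
    by move=> n s _ _; rewrite lee_fin t0.
  by move=> n _; apply/measurable_EFinP.
have k0 x y : (0 <= k x y)%E.
  rewrite lee_fin -lerBlDr sub0r.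
  by have := norm_msd_h_circle_pt x y c; rewrite ler_norml => /andP[].
have mk : measurable_fun setT (fun z : R * R => k z.1 z.2).
  apply/measurable_EFinP; apply: measurable_funD; last exact: measurable_cst.
  exact: measurable_msd_h_circle_pt.
have mk1 y : measurable_fun setT (fun x : R => k x y).
  by have := measurableT_comp mk (measurable_pair2 y).
have kper y x : k (x + 2 * pi) y = k x y by rewrite /k circle_ptD2pi.
suff key y : (forall s, 0 < s < pi -> (k (c + pi + s)%R y + k (c + pi - s)%R y)%E =
    (4%:E + \sum_(0 <= n <oo) (t n s)%:E)%E) -> (\int[unif_angle]_x k x y = v)%E.
  by split; apply: key => s s0pi; have [] := msd_hD2_fold c _ _ s0pi b0pi.
move=> ky; rewrite (integral_unif_angle_fold _ (c + pi))// vE; congr (_ * _)%E.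
rewrite integral_itv_bndoo; last first.
  apply: measurable_funS measurableT (@subsetT _ _) _.
  apply: emeasurable_funD; apply: (measurableT_comp (mk1 y)).
    by apply: measurable_funD; [exact: measurable_cst|exact: measurable_id].
  by apply: measurable_funB; [exact: measurable_cst|exact: measurable_id].
rewrite [RHS]integral_itv_bndoo//.
by apply: eq_integral => s; rewrite inE/= in_itv/= => /ky.
Qed.

Lemma integral_msd_hD2 {R : realType} (c : R) :
  (\int[unif_angle \x unif_angle]_z
    (msd_h geodist (circle_pt z.1) (circle_pt z.2) (circle_pt c) + 2)%R%:E =
   (6 - pi ^+ 2 / 3)%R%:E)%E.
Proof.
have pi0 := @pi_gt0 R.
have pn : pi != 0 :> R by rewrite gt_eqF.
set k := fun z : R * R =>
  (msd_h geodist (circle_pt z.1) (circle_pt z.2) (circle_pt c) + 2)%:E.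
have k0 z : (0 <= k z)%E.
  rewrite lee_fin -lerBlDr sub0r.
  by have := norm_msd_h_circle_pt z.1 z.2 c; rewrite ler_norml => /andP[].
have mk : measurable_fun setT k.
  apply/measurable_EFinP; apply: measurable_funD; last exact: measurable_cst.
  exact: measurable_msd_h_circle_pt.
(* The first point is integrated out first, with the second one fixed. *)
rewrite fubini_tonelli2//.
pose t n (b : R) := 2 / (pi ^+ n.+1 * (n.+1%:R * n.+2%:R)) * b ^+ n.+1.
have mt n : measurable_fun setT (t n).
  apply: measurable_funM; first exact: measurable_cst.
  by apply: measurable_funX; exact: measurable_id.
have t0 n (b : R) : 0 <= b <= pi -> 0 <= t n b.
  move=> /andP[b0 _].
  by rewrite mulr_ge0 ?divr_ge0 ?mulr_ge0 ?exprn_ge0 ?pi_ge0.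
pose v (b : R) := (2%:E + \sum_(0 <= n <oo) (t n b)%:E)%E.
have mG : measurable_fun setT (fubini_G (@unif_angle R) k).
  exact: measurable_fun_fubini_tonelli_G.
rewrite (integral_unif_angle_fold _ c)//; last 2 first.
- by move=> y; apply: integral_ge0 => x _; exact: k0.
- by move=> y; apply: eq_integral => x _; rewrite /k/= circle_ptD2pi.
have mv : measurable_fun `[0, pi]%classic v.
  apply: emeasurable_funD; first exact: measurable_cst.
  apply: (@ge0_emeasurable_sum _ _ R `[0, pi]%classic (fun n x => (t n x)%:E) xpredT).
    by move=> n s /=; rewrite in_itv/= lee_fin => s0pi _; exact: t0.
  by move=> n _; apply/measurable_EFinP; exact: measurable_funS (mt n).
have v0 b : `[0, pi]%classic b -> (0 <= v b)%E.
  rewrite /= in_itv/= => b0pi; rewrite adde_ge0//.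
  by apply: nneseries_ge0 => n _ _; rewrite lee_fin t0.
have -> : (\int[lebesgue_measure]_(u in `[0%R, pi])
    (fubini_G unif_angle k (c + u)%R + fubini_G unif_angle k (c - u)%R) =
    \int[lebesgue_measure]_(u in `[0%R, pi]) (v u + v u))%E.
  rewrite integral_itv_bndoo; last first.
    apply: measurable_funS measurableT (@subsetT _ _) _.
    apply: emeasurable_funD; apply: (measurableT_comp mG).
      by apply: measurable_funD; [exact: measurable_cst|exact: measurable_id].
    by apply: measurable_funB; [exact: measurable_cst|exact: measurable_id].
  rewrite [RHS]integral_itv_bndoo; last first.
    by apply: emeasurable_funD; apply: measurable_funS mv => //;
      exact: subset_itv_oo_cc.
  apply: eq_integral => b; rewrite inE/= in_itv/= => b0pi.
  by have [e1 e2] := integral_msd_hD2_arc c _ b0pi; rewrite /fubini_G /k/= e1 e2.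
rewrite ge0_integralD//.
suff -> : (\int[lebesgue_measure]_(u in `[0%R, pi]) v u =
    (2 * pi + 2 * pi * (2 - pi ^+ 2 / 6))%:E)%E.
  rewrite -EFinD -EFinM; congr EFin.
  by move: (pi : R) pn => p pn; field.
rewrite ge0_integral_cst_series ?pi_ge0// subr0 EFinD; congr (_ + _)%E.
(* The comparison is term by term: [b^(n + 1)] integrates to [pi^(n + 2) / (n + 2)], which turns the
   coefficient into [2 pi / ((n + 1) (n + 2)^2)]. *)
rewrite EFinM -(nneseries_EFin_cvg _ _ cvg_sum_inv_mul_sqr) -nneseriesZl; last first.
  by move=> n _; rewrite lee_fin invr_ge0 mulr_ge0.
apply: eq_eseriesr => n _.
under eq_integral do rewrite EFinM.
rewrite ge0_integralZl_EFin//; last 3 first.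
- by move=> b /=; rewrite in_itv/= => /andP[b0 _]; rewrite lee_fin exprn_ge0.
- apply/measurable_EFinP; apply: measurable_funX; exact: measurable_id.
- by rewrite divr_ge0// !mulr_ge0 ?exprn_ge0 ?pi_ge0.
rewrite integral_exprn_itv// -!EFinM; congr EFin.
have pX : pi ^+ n.+1 != 0 :> R by rewrite expf_neq0.
have n1 : n.+1%:R != 0 :> R by rewrite pnatr_eq0.
have n2 : n.+2%:R != 0 :> R by rewrite pnatr_eq0.
rewrite [pi ^+ n.+2]exprS.
move: (pi : R) pn (pi ^+ n.+1) pX n.+1%:R n1 n.+2%:R n2.
move=> p pn p' pX m n1 m' n2.
by field; rewrite pX n1 n2.
Qed.

(** * Integrability of the kernel and value of the depth *)

(** Since [fine] sends infinite values to 0, integrability is what makes the depth a genuine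
    expectation; it holds because [|h| <= 2] on a probability space. *)
Theorem theorem7 (R : realType) (x : R * R) (hx : x \in S1) :
  (unif_angle \x unif_angle)%E.-integrable setT
     (fun z => (msd_h geodist (circle_pt z.1) (circle_pt z.2) x)%:E) /\
  msd_depth unif_angle circle_pt geodist x = pi ^+ 2 / 6 - 1.
Proof.
have [c ->] : exists c, x = circle_pt c by apply: S1_circle_pt; exact: set_mem.
pose h z := msd_h geodist (circle_pt z.1) (circle_pt z.2) (circle_pt c) : R.
have PT : (unif_angle \x unif_angle)%E setT = 1%E :> \bar R.
  have P1 : unif_angle setT = 1%E :> \bar R.
    exact: (probability_setT (uniform_prob (@twopi_gt0 R))).
  rewrite -setXTT product_measure1E// -[RHS]mule1.
  by congr (_ * _)%E; exact: P1.
have PTy : ((unif_angle \x unif_angle) setT < +oo :> \bar R)%E by rewrite PT ltry.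
have ih : (unif_angle \x unif_angle)%E.-integrable setT (EFin \o h).
  apply: measurable_bounded_integrable => //.
  - exact: measurable_msd_h_circle_pt.
  - exists 2; split; first exact: num_real.
    move=> M M2 z _; apply: le_trans (ltW M2).
    exact: norm_msd_h_circle_pt.
split; first exact: ih.
have i2 : (unif_angle \x unif_angle)%E.-integrable setT (EFin \o cst (2 : R)).
  apply: measurable_bounded_integrable => //.
  by exists 2; split; [exact: num_real|move=> M M2 z _ /=; rewrite ger0_norm// ltW].
have iD := integralD_EFin measurableT ih i2.
rewrite /msd_depth /msd_expect.
suff : (\int[unif_angle \x unif_angle]_z (h z)%:E + 2%:E = (6 - pi ^+ 2 / 3)%R%:E)%E.
  (* An infinite integral of [h] would contradict the finite value of its sum with 2. *)
  by move: (\int[_]_z _)%E => [r [rE]|//|//] /=; lra.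
rewrite -(integral_msd_hD2 c) [RHS]iD; congr (_ + _)%E.
have := integral_cst (unif_angle \x unif_angle)%E measurableT (2 : R)%:E.
by move=> ->; rewrite -[LHS]mule1; congr (_ * _)%E; exact: esym PT.
Qed.
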